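(* Let $0\le\alpha<1$ and let $n,k,m$ be positive integers with $1\le k\le n-2$ and $1\le m\le n-k-1$. Then $$\lambda_\alpha(K(n,k,m))=\frac{n-2-\alpha m+\alpha n+\sqrt{(1-\alpha)^2n^2+(6\alpha-2\alpha^2-4)mn+(2-\alpha)^2m^2+4(1-\alpha)km}}{2}.$$
   Context: For a simple digraph $G$, $A(G)$ is the adjacency matrix, $D(G)$ the diagonal matrix of outdegrees, $A_\alpha(G)=\alpha D(G)+(1-\alpha)A(G)$, and $\lambda_\alpha(G)$ is the largest modulus of the eigenvalues of $A_\alpha(G)$. $K(n,k,m)$ is the digraph whose vertex set is partitioned into sets $S$, $V_1$, $V_2$ with $|S|=k$, $|V_1|=m$, $|V_2|=n-k-m$, and whose arcs are all ordered pairs $(u,v)$ of distinct vertices except those with $u\in V_2$ and $v\in V_1$ (i.e. $S\cup V_1$ and $S\cup V_2$ each induce complete digraphs, and all arcs from $V_1$ to $V_2$ are present, none from $V_2$ to $V_1$). *)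

(* Defs.v *)
From HB Require Import structures.
From mathcomp Require Import all_boot all_order all_algebra.
From mathcomp Require Import complex.

Set Implicit Arguments.
Unset Strict Implicit.
Unset Printing Implicit Defensive.

Import Order.TTheory GRing.Theory Num.Theory.
Local Open Scope ring_scope.

(* Simple digraphs on n vertices. Since arcs form a relation there are no
   multiple arcs, and irreflexivity excludes loops. *)
Record sdigraph (n : nat) := SDigraph {
  arc :> rel 'I_n;
  arc_irr : irreflexive arc }.

Definition outdeg (n : nat) (G : sdigraph n) (u : 'I_n) : nat :=
  #|[set v | arc G u v]|.

Section Matrices.
Variables (R : rcfType) (n : nat).
Implicit Types (G : sdigraph n) (M : 'M[R]_n).

Definition adjmx G : 'M[R]_n := \matrix_(i, j) (arc G i j)%:R.

Definition outdegmx G : 'M[R]_n := diag_mx (\row_i (outdeg G i)%:R).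

Definition Aalpha (alpha : R) G : 'M[R]_n :=
  alpha *: outdegmx G + (1 - alpha) *: adjmx G.

Definition complexmx M : 'M[R[i]]_n := map_mx (real_complex R) M.

(* The eigenvalues in R[i], with algebraic multiplicity; see mem_spectrum. *)
Definition spectrum M : seq R[i] :=
  sval (closed_field_poly_normal (char_poly (complexmx M))).

(* The default 0 of the maximum matters only when n = 0; see
   spectral_radiusP. *)
Definition spectral_radius M : R :=
  \big[Num.max/0]_(z <- spectrum M) Normc.normc z.

Definition lambda (alpha : R) G : R := spectral_radius (Aalpha alpha G).

Lemma mem_spectrum M z : (z \in spectrum M) = eigenvalue (complexmx M) z.
Proof.
rewrite eigenvalue_root_char /spectrum.
case: closed_field_poly_normal => s /= ->.
by rewrite (monicP (char_poly_monic _)) scale1r root_prod_XsubC.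
Qed.

Lemma spectral_radiusP M : (0 < n)%N ->
  (exists2 z, eigenvalue (complexmx M) z & Normc.normc z = spectral_radius M)
  /\ (forall z, eigenvalue (complexmx M) z ->
        Normc.normc z <= spectral_radius M).
Proof.
move=> n_gt0; split; last first.
  move=> z; rewrite -mem_spectrum /spectral_radius => z_s.
  by apply: le_bigmax_seq z_s _.
have nz (z : R[i]) : 0 <= Normc.normc z by case: z => a b; exact: sqrtr_ge0.
have : spectrum M != [::].
  apply/eqP => s0; have /(congr1 (fun p : {poly R[i]} => size p)) :=
    svalP (closed_field_poly_normal (char_poly (complexmx M))).
  rewrite -/(spectrum M) s0 big_nil (monicP (char_poly_monic _)) scale1r.
  by rewrite size_char_poly size_poly1 => -[n0]; rewrite n0 in n_gt0.
suff H (s : seq R[i]) : s != [::] ->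
    exists2 z, z \in s & Normc.normc z = \big[Num.max/0]_(w <- s) Normc.normc w.
  by move=> /H[z zs zE]; exists z => //; rewrite -mem_spectrum.
elim: s => // x s IHs _; rewrite big_cons.
have [->|/IHs[z zs zE]] := eqVneq s [::].
  by exists x; rewrite ?mem_head // big_nil max_l.
rewrite -zE; case: (leP (Normc.normc x) (Normc.normc z)) => _.
  by exists z => //; rewrite inE zs orbT.
by exists x; rewrite ?mem_head.
Qed.

End Matrices.

(* G is K(n, k, m), for some choice of the parts S, V1, V2; the paper's K is
   determined only up to the labelling of its vertices. *)
Definition is_K (n k m : nat) (G : sdigraph n) : Prop :=
  exists S V1 V2 : {set 'I_n},
    [/\ [/\ S :|: V1 :|: V2 = [set: 'I_n], [disjoint S & V1],
            [disjoint S & V2] & [disjoint V1 & V2]],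
        [/\ #|S| = k, #|V1| = m & #|V2| = (n - k - m)%N] &
        forall u v : 'I_n,
          arc G u v = (u != v) && ~~ ((u \in V2) && (v \in V1))].

Arguments is_K : clear implicits.

Lemma is_K_exists (n k m : nat) : (k + m <= n)%N -> exists G, is_K n k m G.
Proof.
move=> le_n.
have card_lt (p : nat) : (p <= n)%N -> #|[set i : 'I_n | (i < p)%N]| = p.
  move=> pn; rewrite -sum1dep_card.
  by rewrite (big_ord_narrow pn) /= sum_nat_const card_ord muln1.
pose S := [set i : 'I_n | (i < k)%N].
pose T := [set i : 'I_n | (i < k + m)%N].
have kn : (k <= n)%N := leq_trans (leq_addr m k) le_n.
have ST : S \subset T.
  by apply/subsetP => i; rewrite !inE => /leq_trans; apply; rewrite leq_addr.
pose r (u v : 'I_n) := (u != v) && ~~ ((u \in ~: T) && (v \in T :\: S)).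
have r_irr : irreflexive r by move=> u; rewrite /r eqxx.
exists (SDigraph r_irr), S, (T :\: S), (~: T); split=> //; split.
- apply/setP => i; rewrite !inE; have := subsetP ST i; rewrite !inE.
  by case: (i < k)%N => //=; case: (i < k + m)%N.
- rewrite -setI_eq0; apply/eqP/setP => i; rewrite !inE.
  by case: (i < k)%N.
- rewrite -setI_eq0; apply/eqP/setP => i; rewrite in_setI in_setC in_set0.
  by apply/negbTE/negP => /andP[/(subsetP ST)->].
- rewrite -setI_eq0; apply/eqP/setP => i; rewrite !inE.
  by case: (i < k + m)%N; rewrite ?andbF.
- exact: card_lt.
- by rewrite cardsD (setIidPr ST) !card_lt // addKn.
- by rewrite cardsCs setCK card_ord card_lt // subnDA.
Qed.

(* Main.v *)
Require Import Defs.
From mathcomp Require Import all_boot all_order all_algebra.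
From mathcomp Require Import complex ring zify.

Import Order.TTheory GRing.Theory Num.Theory.
Local Open Scope ring_scope.

(** The vector constant on [S :|: V1] and on [V2], with values given by a
positive eigenvector of the 2 x 2 quotient matrix, is a positive right
eigenvector of the nonnegative matrix [Aalpha alpha G]. By the easy half of
Perron-Frobenius its eigenvalue, the larger root of the characteristic
polynomial of the quotient matrix, is the spectral radius. *)

(** [M^T - a] is the transpose of [M - a], so their ranks agree. This lets a right eigenvector
    witness an [eigenvalue]. *)
Lemma eigenvalue_trmx (F : fieldType) (n : nat) (M : 'M[F]_n) (a : F) :
  eigenvalue M^T a = eigenvalue M a.
Proof.
rewrite /eigenvalue /eigenspace !kermx_eq0 /row_free.
by rewrite -[a%:M in LHS]tr_scalar_mx -linearB mxrank_tr.
Qed.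

(* [eigenvalue] is about left eigenvectors [v]: pairing the inequality
   [|z| |v| <= |v| M] with the positive right eigenvector [x] bounds [|z|]. *)
Lemma eigenvalue_norm_le (F : numFieldType) (n : nat) (M : 'M[F]_n)
    (x : 'cV[F]_n) (rho z : F) :
  (forall i j, 0 <= M i j) -> (forall i, 0 < x i 0) -> M *m x = rho *: x ->
  eigenvalue M z -> `|z| <= rho.
Proof.
move=> M_ge0 x_gt0 Mx /eigenvalueP[v vM v_neq0].
have [j0 vj0] : exists j, v 0 j != 0 by apply/rV0Pn.
have pairing_gt0 : 0 < \sum_j `|v 0 j| * x j 0.
  rewrite (bigD1 j0) //= ltr_pwDl ?mulr_gt0 ?normr_gt0 //.
  by apply: sumr_ge0 => j _; rewrite mulr_ge0 // ltW.
rewrite -(ler_pM2r pairing_gt0) mulr_sumr.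
apply: (@le_trans _ _ (\sum_j \sum_i `|v 0 i| * M i j * x j 0)).
  apply: ler_sum => j _; rewrite mulrA -normrM -mulr_suml.
  have /rowP/(_ j) := vM; rewrite !mxE => <-.
  rewrite ler_wpM2r ?(ltW (x_gt0 j)) //.
  apply: le_trans (ler_norm_sum _ _ _) _; apply: ler_sum => i _.
  by rewrite normrM (ger0_norm (M_ge0 i j)).
rewrite exchange_big mulr_sumr /=; apply: ler_sum => i _.
have /colP/(_ i) := Mx; rewrite !mxE => Mxi.
rewrite mulrCA -Mxi mulr_sumr.
by apply: ler_sum => j _; rewrite mulrA.
Qed.

(** Over [R[i]], [rho] is itself an eigenvalue, and [eigenvalue_norm_le] bounds the modulus of every
    other one by it. *)
Lemma spectral_radius_pos_eigenvector (R : rcfType) (n : nat) (M : 'M[R]_n)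
    (x : 'cV[R]_n) (rho : R) :
  (0 < n)%N -> (forall i j, 0 <= M i j) -> (forall i, 0 < x i 0) ->
  M *m x = rho *: x -> spectral_radius M = rho.
Proof.
move=> n_gt0 M_ge0 x_gt0 Mx.
(* The norm on [R[i]] takes values in [R[i]], whereas [spectral_radius] uses the [R]-valued
   [normc]. *)
have normE (z : R[i]) : `|z| = real_complex R (Normc.normc z) by [].
pose cx := map_mx (real_complex R) x.
have cx_gt0 i : 0 < cx i 0 by rewrite mxE ltcR.
have cMx : complexmx M *m cx = real_complex R rho *: cx.
  by rewrite -map_mxM Mx map_mxZ.
have cM_ge0 i j : 0 <= complexmx M i j by rewrite mxE lecR.
have rho_ge0 : 0 <= rho.
  pose i0 := Ordinal n_gt0.
  rewrite -(pmulr_lge0 _ (x_gt0 i0)).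
  have /colP/(_ i0) := Mx; rewrite !mxE => <-.
  by apply: sumr_ge0 => j _; rewrite mulr_ge0 // ltW.
have rho_eig : eigenvalue (complexmx M) (real_complex R rho).
  rewrite -eigenvalue_trmx; apply/eigenvalueP; exists cx^T.
    by rewrite -trmx_mul cMx linearZ.
  apply/rV0Pn; exists (Ordinal n_gt0).
  by rewrite mxE gt_eqF.
have [[z z_eig <-] rad_ge] := @spectral_radiusP R n M n_gt0.
apply/le_anti/andP; split.
  rewrite -lecR -[X in X <= _]normE.
  exact: eigenvalue_norm_le cM_ge0 cx_gt0 cMx z_eig.
by rewrite (le_trans _ (rad_ge _ rho_eig)) // -lecR -normE ger0_norm ?lecR.
Qed.

Lemma Aalpha_mul_cV (R : rcfType) (n : nat) (alpha : R) (G : sdigraph n)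
    (x : 'cV[R]_n) (u : 'I_n) :
  (Aalpha alpha G *m x) u 0 =
    alpha * (outdeg G u)%:R * x u 0
    + (1 - alpha) * \sum_v (G u v)%:R * x v 0.
Proof.
rewrite /Aalpha mulmxDl -!scalemxAl mul_diag_mx !mxE mulrA.
by congr (_ + _ * _); apply: eq_bigr => v _; rewrite mxE.
Qed.

(** The arc indicator is 1 minus that of [u = v] minus that of a pair from [V2] to [V1].
    Disjointness keeps a loop from being subtracted twice. *)
Lemma sum_arc_K (R : rcfType) (n : nat) (G : sdigraph n) (V1 V2 : {set 'I_n})
    (y : 'I_n -> R) (u : 'I_n) :
  [disjoint V1 & V2] ->
  (forall u v, G u v = (u != v) && ~~ ((u \in V2) && (v \in V1))) ->
  \sum_v (G u v)%:R * y v =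
    \sum_v y v - y u - (u \in V2)%:R * \sum_(v in V1) y v.
Proof.
move=> dis12 arcE.
have -> : y u = \sum_v (u == v)%:R * y v.
  rewrite (bigD1 u) //= eqxx mul1r big1 ?addr0 // => v.
  by rewrite eq_sym => /negbTE->; rewrite mul0r.
rewrite [X in _ - _ * X]big_mkcond mulr_sumr -!sumrB /=.
apply: eq_bigr => v _; rewrite arcE.
have [<-|_] := eqVneq u v.
  have [u1|] := boolP (u \in V1); last by move=> _; rewrite /=; ring.
  by rewrite (disjointFr dis12 u1) /=; ring.
by case: (u \in V2); case: (v \in V1) => /=; ring.
Qed.

Theorem theorem5p1 (R : rcfType) (alpha : R) (n k m : nat)
    (alpha_ge0 : 0 <= alpha) (alpha_lt1 : alpha < 1)
    (k_ge1 : (1 <= k)%N) (k_le : (k <= n - 2)%N)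
    (m_ge1 : (1 <= m)%N) (m_le : (m <= n - k - 1)%N)
    (G : sdigraph n) (GK : is_K n k m G) :
  lambda alpha G =
    (n%:R - 2 - alpha * m%:R + alpha * n%:R
     + Num.sqrt ((1 - alpha) ^+ 2 * n%:R ^+ 2
                 + (6 * alpha - 2 * alpha ^+ 2 - 4) * m%:R * n%:R
                 + (2 - alpha) ^+ 2 * m%:R ^+ 2
                 + 4 * (1 - alpha) * k%:R * m%:R)) / 2.
Proof.
have [S [V1 [V2 [[_ _ _ dis12] [_ card1 card2] arcE]]]] := GK.
have n_gt0 : (0 < n)%N by lia.
pose b := 1 - alpha; have b_gt0 : 0 < b by rewrite subr_gt0.
set D := (X in Num.sqrt X); set s := Num.sqrt D; set rho := (X in _ = X).
have [p_gt0 pE] : 0 < (n - k - m)%:R :> R /\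
    (n - k - m)%:R = n%:R - k%:R - m%:R :> R.
  by split; [rewrite ltr0n; lia | rewrite !natrB //; lia].
set p : R := (n - k - m)%:R in p_gt0 pE.
have k_gt0 : 0 < k%:R :> R by rewrite ltr0n.
(* [d] is the difference of the diagonal entries of the quotient matrix, whose
   off-diagonal entries are [b * p] and [b * k]; [(b * p, c)] is its eigenvector
   for [rho]. *)
pose d := alpha * m%:R + b * (k%:R + m%:R - p).
(* [D] is the discriminant of the characteristic polynomial of the quotient matrix. *)
have DE : D = d ^+ 2 + 4 * b ^+ 2 * k%:R * p by rewrite /D /d /b pE; ring.
have D_gt : d ^+ 2 < D by rewrite DE ltrDl !mulr_gt0 // exprn_gt0.
have sE : s ^+ 2 = D by rewrite sqr_sqrtr // (le_trans (sqr_ge0 d)) ?ltW.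
pose c := (s - d) / 2.
(* The strict bound [d ^+ 2 < D] gives [d <= |d| < s]. *)
have c_gt0 : 0 < c.
  rewrite divr_gt0 // subr_gt0 (le_lt_trans (ler_norm d)) //.
  by rewrite -sqrtr_sqr ltr_sqrt // (le_lt_trans _ D_gt) ?sqr_ge0.
pose x : 'cV[R]_n := \col_v (b * p + (v \in V2)%:R * (c - b * p)).
have x_gt0 v : 0 < x v 0.
  rewrite mxE; case: (v \in V2); last by rewrite mul0r addr0 mulr_gt0.
  by rewrite mul1r addrC subrK.
have A_ge0 i j : 0 <= Aalpha alpha G i j.
  rewrite !mxE; apply: addr_ge0; apply: mulr_ge0 => //.
  - by rewrite mulrn_wge0.
  - exact: ltW.
apply: spectral_radius_pos_eigenvector n_gt0 A_ge0 x_gt0 _.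
have sum_x : \sum_v x v 0 = n%:R * (b * p) + p * (c - b * p).
  under eq_bigr do rewrite mxE.
  rewrite big_split /= sumr_const card_ord -mulr_suml -[_ *+ n]mulr_natl.
  have -> // : \sum_v (v \in V2)%:R = p.
  rewrite /p -card2 -sum1_card natr_sum [RHS]big_mkcond.
  by apply: eq_bigr => v _; case: (v \in V2).
have sum_x1 : \sum_(v in V1) x v 0 = m%:R * (b * p).
  rewrite -card1 mulr_natl -sumr_const; apply: eq_bigr => v v1.
  by rewrite mxE (disjointFr dis12 v1) mul0r addr0.
apply/colP => u; rewrite Aalpha_mul_cV mxE.
have -> : (outdeg G u)%:R = n%:R - 1 - (u \in V2)%:R * m%:R :> R.
  (* The outdegree is the arc sum of the constant 1. *)
  have := sum_arc_K R n G V1 V2 (fun=> 1) u dis12 arcE.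
  rewrite !sumr_const card_ord card1 => <-.
  rewrite /outdeg -sum1dep_card natr_sum big_mkcond.
  by apply: eq_bigr => v _; rewrite mulr1; case: (G u v).
rewrite (sum_arc_K R n G V1 V2 (fun v => x v 0) u dis12 arcE) sum_x sum_x1 !mxE.
have rhoE : rho = (n%:R - 2 - alpha * m%:R + alpha * n%:R + s) / 2 by [].
apply/eqP; rewrite -subr_eq0; apply/eqP.
(* These are the two rows of the quotient eigenvector equation. The [V2] row is quadratic in [s] and
   needs [s ^+ 2 = D]; the other is linear in [s] and holds identically. *)
case: (u \in V2); rewrite rhoE /=.
  transitivity ((D - s ^+ 2) / 4); last by rewrite sE subrr mul0r.
  by rewrite DE /c /d /b pE; field.
by rewrite /c /d /b pE; field.
Qed.
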